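(* Let $n\ge 2$ be an integer and let $x_1,\dots,x_n:[0,1]\to[0,1]$ be the coordinate functions of the $n$-dimensional Peano curve, as defined in the context. Then the map $$\alpha:[0,1]\to[0,1]^n,\qquad \alpha(t)=(x_1(t),\dots,x_n(t)),$$ is continuous and surjective.
   Context: Fix an integer $n\ge 2$; $\mathbb{N}=\{1,2,3,\dots\}$. Let $D=\{0,1,2\}$ and let $\mathcal{S}_D$ be the set of all sequences $\mathbf{t}=(t_k)_{k\in\mathbb{N}}$ with $t_k\in D$. Let $\xi:D\to D$, $\xi(a)=2-a$, and let $\xi^m$ denote its $m$-fold iterate ($\xi^0=\mathrm{id}$). For $1\le i\le n$, $j\ge 0$ and $\mathbf{t}\in\mathcal{S}_D$ put $$S_{i+jn}(\mathbf{t})=\sum_{k=1}^{i+jn}t_k-\sum_{s=0}^{j}t_{i+sn}\quad(\text{a nonnegative integer}),\qquad x_i(\mathbf{t})=\sum_{j=0}^{\infty}\frac{\xi^{S_{i+jn}(\mathbf{t})}(t_{i+jn})}{3^{j+1}}\in[0,1].$$ Let $\Phi:\mathcal{S}_D\to[0,1]$, $\Phi(\mathbf{t})=\sum_{k\ge1}t_k/3^k$. An element $\mathbf{t}\in\Phi^{-1}(t)$ is called a ternary representation of $t\in[0,1]$. The value $x_i(\mathbf{t})$ is the same for all ternary representations $\mathbf{t}$ of a given $t$, so the function $x_i:[0,1]\to[0,1]$, $x_i(t):=x_i(\mathbf{t})$ for any $\mathbf{t}\in\Phi^{-1}(t)$, is well defined. The map $\alpha=(x_1,\dots,x_n)$ is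 called the $n$-dimensional Peano curve. *)

(* Defs.v *)
From mathcomp Require Import all_boot all_order all_algebra.
From mathcomp Require Import all_classical all_reals all_analysis.

Set Implicit Arguments.
Unset Strict Implicit.
Unset Printing Implicit Defensive.

Import Order.TTheory GRing.Theory Num.Theory.
Import numFieldNormedType.Exports.

Local Open Scope classical_set_scope.
Local Open Scope ring_scope.

(** Indices are shifted by one: for [t : nat -> 'I_3], [t k] is the digit
    t_{k+1}, and [i : 'I_n] stands for the coordinate number i+1; hence the
    position i+jn of the mathematical text is again written [i + j * n]. *)

Definition xi (a : 'I_3) : 'I_3 := rev_ord a.

Lemma xiE (a : 'I_3) : xi a = (2 - a)%N :> nat.
Proof. by []. Qed.

(** The sum of the first i+jn digits minus those at positions congruent to i.
    The subtracted digits all occur in the first sum, so the truncation of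
    subtraction on [nat] plays no role. *)
Definition digit_sum (n i j : nat) (t : nat -> 'I_3) : nat :=
  (\sum_(k < (i + j * n).+1) t k - \sum_(s < j.+1) t (i + s * n))%N.

Definition seq_coord (R : realType) (n i : nat) (t : nat -> 'I_3) : R :=
  limn (series (fun j : nat =>
    (iter (digit_sum n i j t) xi (t (i + j * n)%N))%:R / 3 ^+ j.+1 : R)).

Definition ternary_value (R : realType) (t : nat -> 'I_3) : R :=
  limn (series (fun k : nat => (t k)%:R / 3 ^+ k.+1 : R)).

(** The common value of [seq_coord R n i] on all ternary representations of
    [x]; only meaningful for [x] in [0, 1]. *)
Definition peano_coord (R : realType) (n i : nat) (x : R) : R :=
  xget 0 [set v | forall t, ternary_value R t = x -> seq_coord R n i t = v].

Definition peano_curve (R : realType) (n : nat) (x : R) : 'rV[R]_n :=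
  \row_(i < n) peano_coord n i x.

Definition unit_cube (R : realType) (n : nat) : set 'rV[R]_n :=
  [set v : 'rV[R]_n | forall i : 'I_n, v ord0 i \in `[0, 1]].

(* Main.v *)
(** If two points of [0, 1] are less than 3^-(N n) apart, the first N n digits of
    their ternary representations form the expansions of equal or consecutive
    integers: they agree up to a carry position p, where the digit increases by
    one, and continue with 2s and 0s respectively.  Positions after p in the
    residue class of p see the same parity of digit sums on both sides, so the
    coordinate with that class again undergoes one carry (in a direction given
    by the parity); in the other classes the parities differ, which turns the 2s
    and 0s into equal digits.  Hence every coordinate moves by at most 2 * 3^-N,
    which yields at once the independence of the chosen representation and
    uniform continuity.  For surjectivity the digits are determined recursively,
    since the exponent of xi at a position only involves earlier digits. *)

Require Import Defs.
From mathcomp Require Import all_boot all_order all_algebra.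
From mathcomp Require Import all_classical all_reals all_analysis.
From mathcomp Require Import zify lra.

Import Order.TTheory GRing.Theory Num.Theory.
Import numFieldNormedType.Exports.

Local Open Scope classical_set_scope.
Local Open Scope ring_scope.

(** * Ternary expansions: values, carries, existence *)

Definition shift (t : nat -> 'I_3) : nat -> 'I_3 := fun k => t k.+1.

Section TernaryExpansions.
Context {R : realType}.
Implicit Types (t u : nat -> 'I_3) (m : nat).
Local Notation V := (ternary_value R).

Lemma expr3VS m : (3 : R) ^- m.+1 = 3 ^- m / 3.
Proof. by rewrite exprSr invfM mulrC. Qed.

Lemma expr3V_gt0 m : 0 < (3 : R) ^- m.
Proof. by rewrite invr_gt0 exprn_gt0. Qed.

Lemma expr3V_le1 m : (3 : R) ^- m <= 1.
Proof. by rewrite invf_le1 ?exprn_gt0 // exprn_ege1 // ler1n. Qed.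

Lemma expr3V_lt (e : R) : 0 < e -> exists m, (3 : R) ^- m < e.
Proof.
move=> e0; exists (Num.bound e^-1).
rewrite invf_plt ?posrE ?exprn_gt0 //.
have einv0 : 0 <= e^-1 by rewrite invr_ge0 ltW.
apply: (lt_trans (archi_boundP einv0)).
by rewrite -natrX ltr_nat ltn_expl.
Qed.

Definition ternary_sum t := series (fun k : nat => (t k)%:R / 3 ^+ k.+1 : R).

Lemma digit_le2 (a : 'I_3) : (a : nat)%:R <= 2 :> R.
Proof. by rewrite (ler_nat R _ 2) -ltnS. Qed.

(** The sharp bound makes the induction close: a new digit adds at most two thirds of the remaining
    gap [3 ^- m]. *)
Lemma ternary_sum_le t m : ternary_sum t m <= 1 - 3 ^- m.
Proof.
elim: m => [|m IH]; first by rewrite /ternary_sum /series /= big_geq // expr0 invr1 subrr.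
rewrite /ternary_sum seriesSr -/(ternary_sum t m) expr3VS.
have := digit_le2 (t m); have := expr3V_gt0 m.
move: (3 ^- m) IH => e IH e0 t2; nra.
Qed.

Lemma ternary_sum_cvg t : cvgn (ternary_sum t).
Proof.
apply: nondecreasing_is_cvgn.
  apply/nondecreasing_seqP => m.
  by rewrite /ternary_sum seriesSr lerDl divr_ge0 // exprn_ge0.
exists 1 => _ [m _ <-].
by apply: le_trans (ternary_sum_le t m) _; rewrite gerBl ltW ?expr3V_gt0.
Qed.

Lemma ternary_value_ge0 t : 0 <= V t.
Proof.
apply: limr_ge; first exact: ternary_sum_cvg.
by near=> m; apply: sumr_ge0 => k _; rewrite divr_ge0 // exprn_ge0.
Unshelve. all: by end_near. Qed.

Lemma ternary_value_le1 t : V t <= 1.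
Proof.
apply: limr_le; first exact: ternary_sum_cvg.
near=> m; apply: le_trans (ternary_sum_le t m) _.
by rewrite gerBl ltW ?expr3V_gt0.
Unshelve. all: by end_near. Qed.

(** This recursion on the leading digit drives the inductions on [m] below. *)
Lemma ternary_valueE t : V t = ((t 0)%:R + V (shift t)) / 3.
Proof.
apply: cvg_lim => //; rewrite -cvg_shiftS.
have -> : [sequence ternary_sum t m.+1]_m =
    (fun m => ((t 0)%:R + ternary_sum (shift t) m) / 3).
  apply/funext => m /=; rewrite /ternary_sum /series /= big_nat_recl //.
  rewrite mulrDl expr1 mulr_suml; congr (_ + _).
  by apply: eq_bigr => k _; rewrite [in LHS]exprSr invfM mulrA mulrAC.
apply: cvgMl; apply: cvgD; first exact: cvg_cst.
exact: ternary_sum_cvg.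
Qed.

Lemma ternary_value_agree m t u :
  (forall k, (k < m)%N -> t k = u k) -> `|V t - V u| <= 3 ^- m.
Proof.
elim: m t u => [|m IH] t u tu.
  rewrite expr0 invr1 ler_norml.
  have := ternary_value_ge0 t; have := ternary_value_le1 t.
  have := ternary_value_ge0 u; have := ternary_value_le1 u; lra.
have /IH : forall k, (k < m)%N -> shift t k = shift u k.
  by move=> k km; apply: tu.
rewrite (ternary_valueE t) (ternary_valueE u) tu // expr3VS !ler_norml; lra.
Qed.

Lemma ternary_value_zeros m t :
  (forall k, (k < m)%N -> t k = 0%N :> nat) -> V t <= 3 ^- m.
Proof.
elim: m t => [|m IH] t t0; first by rewrite expr0 invr1 ternary_value_le1.
have /IH : forall k, (k < m)%N -> shift t k = 0%N :> nat.
  by move=> k km; apply: t0.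
rewrite (ternary_valueE t) t0 // expr3VS; lra.
Qed.

Lemma ternary_value_twos m t :
  (forall k, (k < m)%N -> t k = 2%N :> nat) -> 1 - V t <= 3 ^- m.
Proof.
elim: m t => [|m IH] t t2.
  by rewrite expr0 invr1 gerBl ternary_value_ge0.
have /IH : forall k, (k < m)%N -> shift t k = 2%N :> nat.
  by move=> k km; apply: t2.
rewrite (ternary_valueE t) t2 // expr3VS; lra.
Qed.

(** A nonzero leading digit already contributes 1/3. The bound is strict because, for [m > 0],
    [3 ^- m] also has an expansion with a 1 at position [m-1]. *)
Lemma zeros_of_ternary_value m t k :
  V t < 3 ^- m -> (k < m)%N -> t k = 0%N :> nat.
Proof.
elim: m t k => [//|m IH] t k; rewrite ternary_valueE expr3VS => Vt km.
have := ternary_value_ge0 (shift t); have := expr3V_le1 m => e1 V0.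
have t00 : t 0 = 0%N :> nat.
  apply/eqP; rewrite eqn0Ngt; apply/negP; rewrite -(ler_nat R) => t1; lra.
case: k km => [//|k] km; apply: (IH (shift t)) => //.
by move: Vt; rewrite t00; lra.
Qed.

Lemma twos_of_ternary_value m t k :
  1 - V t < 3 ^- m -> (k < m)%N -> t k = 2%N :> nat.
Proof.
elim: m t k => [//|m IH] t k; rewrite ternary_valueE expr3VS => Vt km.
have := ternary_value_le1 (shift t); have := expr3V_le1 m => e1 V1.
have t02 : t 0 = 2%N :> nat.
  apply/eqP; rewrite eqn_leq -ltnS ltn_ord ltnNge /=; apply/negP.
  by rewrite -(ler_nat R) => t1; lra.
case: k km => [//|k] km; apply: (IH (shift t)) => //.
by move: Vt; rewrite t02; lra.
Qed.

(* The words [t 0 .. t (m-1)] and [u 0 .. u (m-1)] are equal (case [m <= p])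
   or are the base-3 expansions of consecutive integers, the carry stopping at
   position [p]. *)
Definition carry m p t u : Prop :=
  [/\ forall k, (k < p)%N -> (k < m)%N -> t k = u k,
      (p < m)%N -> u p = (t p).+1 :> nat
    & forall k, (p < k)%N -> (k < m)%N -> t k = 2%N :> nat /\ u k = 0%N :> nat].

Lemma carryS m p t u :
  t 0 = u 0 -> carry m p (shift t) (shift u) -> carry m.+1 p.+1 t u.
Proof.
move=> tu0 [eq_tu up tail]; split=> [[|k] //|//|[|k] //]; first exact: eq_tu.
exact: tail.
Qed.

(** A digit gap of two would leave the values at least 1/3 apart, as the tails differ by at most 1.
    With gap one, [V u - V t] is a third of the sum of the nonnegative terms [1 - V (shift t)] and
    [V (shift u)]; both are therefore small, which forces 2s and 0s. *)
Lemma carry_of_lt m t u : (t 0 < u 0)%N -> `|V t - V u| < 3 ^- m ->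
  carry m 0 t u.
Proof.
case: m => [|m] tu; first by [].
rewrite (ternary_valueE t) (ternary_valueE u) expr3VS ltr_norml => /andP[lb _].
have := expr3V_le1 m => e1.
have := ternary_value_ge0 (shift t); have := ternary_value_le1 (shift t).
have := ternary_value_ge0 (shift u); have := ternary_value_le1 (shift u).
move=> u1 u0 t1 t0.
have u_t : u 0 = (t 0).+1 :> nat.
  apply/eqP; rewrite eqn_leq tu andbT leqNgt; apply/negP.
  rewrite -(ler_nat R) -[(t 0).+2%:R]natr1 -[(t 0).+1%:R]natr1 => h; lra.
move: lb; rewrite u_t -[(t 0).+1%:R]natr1 => lb.
split=> // -[//|k] _; rewrite ltnS => km; split.
  by apply: (twos_of_ternary_value m (shift t)) => //; lra.
by apply: (zeros_of_ternary_value m (shift u)) => //; lra.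
Qed.

Lemma carry_of_close m t u : `|V t - V u| < 3 ^- m ->
  exists p, carry m p t u \/ carry m p u t.
Proof.
elim: m t u => [|m IH] t u tu; first by exists 0%N; left.
have [ltu|gtu|/ord_inj tu0] := ltngtP (t 0) (u 0).
- by exists 0%N; left; apply: carry_of_lt.
- by exists 0%N; right; apply: carry_of_lt => //; rewrite distrC.
have /IH[p [h|h]] : `|V (shift t) - V (shift u)| < 3 ^- m.
- by move: tu; rewrite (ternary_valueE t) (ternary_valueE u) tu0 expr3VS !ltr_norml; lra.
- by exists p.+1; left; apply: carryS.
- by exists p.+1; right; apply: carryS.
Qed.

(** After the carry the tails are nearly 1 and nearly 0, and the increased digit compensates for
    that 1; the two errors add up to the factor 2. *)
Lemma close_of_carry m p t u : carry m p t u -> `|V t - V u| <= 2 * 3 ^- m.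
Proof.
have [mp [eq_tu _ _]|] := leqP m p.
  apply: le_trans (ternary_value_agree m t u _) _.
    by move=> k km; apply: eq_tu (leq_trans km mp) km.
  by rewrite ler_peMl ?ler1n // ltW ?expr3V_gt0.
elim: p m t u => [|p IH] [//|m] t u pm [eq_tu up tail]; last first.
  have /IH : carry m p (shift t) (shift u).
    split=> [k kp km|//|k pk km]; first exact: eq_tu.
    exact: tail.
  rewrite (ternary_valueE t) (ternary_valueE u) eq_tu // expr3VS !ler_norml.
  by move=> /(_ pm); lra.
have /ternary_value_twos : forall k, (k < m)%N -> shift t k = 2%N :> nat.
  by move=> k km; apply: (proj1 (tail k.+1 _ _)).
have /ternary_value_zeros : forall k, (k < m)%N -> shift u k = 0%N :> nat.
  by move=> k km; apply: (proj2 (tail k.+1 _ _)).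
have := ternary_value_ge0 (shift u); have := ternary_value_le1 (shift t).
rewrite (ternary_valueE t) (ternary_valueE u) up // -[(t 0).+1%:R]natr1 expr3VS !ler_norml.
by have := expr3V_gt0 m; lra.
Qed.

Lemma ternary_value_surj (x : R) : 0 <= x <= 1 -> exists t, V t = x.
Proof.
move=> x01.
(* Greedy digits. The last branch includes [r = 1], so [3 * r - d r] stays in [0, 1]. *)
pose d (r : R) : 'I_3 := if 3 * r < 1 then @inord 2 0 else
  if 3 * r < 2 then @inord 2 1 else @inord 2 2.
pose rem k : R := iter k (fun r => 3 * r - (d r)%:R) x.
have rem01 k : 0 <= rem k <= 1.
  elim: k => [//|k /andP[r0 r1]]; rewrite /rem /= -/(rem k) /d.
  by do 2?case: ifPn; rewrite -?leNgt inordK //; lra.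
pose t k := d (rem k).
(* Stated for all [k], since the induction on [m] passes to the next remainder. *)
have close m : forall k, `|V (fun l => t (k + l)%N) - rem k| <= 3 ^- m.
  elim: m => [|m IH] k.
    have := rem01 k; rewrite expr0 invr1 ler_norml.
    set u := fun l => _; have := ternary_value_ge0 u.
    by have := ternary_value_le1 u; lra.
  rewrite ternary_valueE addn0 expr3VS; have := IH k.+1.
  have -> : shift (fun l => t (k + l)%N) = fun l => t (k.+1 + l)%N.
    by apply/funext => l; rewrite /shift addnS.
  by rewrite /t {2}/rem /= -/(rem k) !ler_norml; lra.
exists t; apply/eqP; rewrite -subr_eq0 -normr_eq0; apply/negPn/negP => nz.
have [|m] := expr3V_lt `|V t - x|; first by rewrite lt_neqAle eq_sym nz normr_ge0.
by rewrite ltNge (close m 0%N).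
Qed.

End TernaryExpansions.

(** * Digits of the coordinates: parities and carries *)

Section PeanoDigits.
Local Open Scope nat_scope.
Variable n : nat.
Implicit Types (t u : nat -> 'I_3).

Lemma modnDM i j : i < n -> (i + j * n) %% n = i.
Proof. by move=> lt_in; rewrite addnC modnMDl modn_small. Qed.

Lemma divnDM i j : i < n -> (i + j * n) %/ n = j.
Proof. by move=> lt_in; rewrite addnC divnMDl ?divn_small ?addn0 //; case: n lt_in. Qed.

Lemma sum_residue_class (F : nat -> nat) i j : i < n ->
  \sum_(0 <= k < (i + j * n).+1 | k %% n == i) F k = \sum_(s < j.+1) F (i + s * n).
Proof.
move=> lt_in; elim: j => [|j IH].
  rewrite mul0n addn0 big_mkcond big_nat_recr //= -big_mkcond big1_seq /=; last first.
    move=> k /andP[/eqP ki]; rewrite mem_index_iota => /andP[_ lt_ki].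
    by move: ki; rewrite modn_small 1?(ltn_trans lt_ki) // => ki; rewrite ki ltnn in lt_ki.
  by rewrite modn_small // eqxx add0n big_ord1 mul0n addn0.
rewrite big_ord_recr -IH /= big_mkcond big_nat_recr //= -big_mkcond modnDM // eqxx; congr (_ + _).
rewrite (@big_cat_nat _ _ _ (i + j * n).+1) //=; last by rewrite mulSn; lia.
rewrite [X in _ + X]big1_seq ?addn0 // => k /andP[/eqP ki].
rewrite mem_index_iota => /andP[lb ub].
move: lb ub; rewrite (divn_eq k n) ki [k %/ n * n + i]addnC !ltn_add2l !ltn_mul2r ltnS.
by move=> /andP[_ lt_jk] /andP[_]; rewrite leqNgt lt_jk.
Qed.

(** The digit at [i + j * n] cancels with its class, so only strictly earlier positions outside the
    class remain. *)
Lemma digit_sumE i j t : i < n ->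
  digit_sum n i j t = \sum_(0 <= k < i + j * n | k %% n != i) t k.
Proof.
move=> lt_in; rewrite /digit_sum -(sum_residue_class (fun k => t k : nat)) //.
rewrite -(big_mkord xpredT (fun k => t k : nat)).
rewrite (bigID (fun k => k %% n == i)) /= addKn big_mkcond big_nat_recr //=.
by rewrite modnDM // eqxx addn0 -big_mkcond.
Qed.

Lemma odd_digit_sum i j t : i < n ->
  odd (digit_sum n i j t) =
  \big[addb/false]_(0 <= k < i + j * n | k %% n != i) odd (t k).
Proof. by move=> lt_in; rewrite digit_sumE // (big_morph odd oddD (erefl _)). Qed.

Lemma iter_xi m a : iter m xi a = if odd m then xi a else a.
Proof.
by elim: m => //= m ->; case: (odd m) => //=; rewrite /xi rev_ordK.
Qed.

(** The digit sequence whose ternary value is, by conversion, [seq_coord R n i t]. *)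
Definition coord_digits i t j : 'I_3 := iter (digit_sum n i j t) xi (t (i + j * n)).

(** Digits before [p] agree, those after it are even on both sides, and at [p] the parity flips; so
    the parities differ exactly when [p] is a counted position. *)
Lemma odd_digit_sum_carry m p t u i j : i < n -> i + j * n < m ->
  carry m p t u ->
  odd (digit_sum n i j u) =
  ((p < i + j * n) && (p %% n != i)) (+) odd (digit_sum n i j t).
Proof.
move=> lt_in lt_m [eq_tu up tail]; rewrite !odd_digit_sum //.
set M := i + j * n in lt_m *.
(* The indicator becomes an exclusive-or sum, so that both sides compare term by term. *)
have -> : (p < M) && (p %% n != i) =
    \big[addb/false]_(0 <= k < M | k %% n != i) (k == p).
  rewrite big_mkord; case: (ltnP p M) => [ltpM|leMp] /=; last first.
    rewrite big1 // => k _; apply/negbTE; rewrite neq_ltn.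
    by rewrite (leq_trans (ltn_ord k) leMp).
  have [pi|pi] := eqVneq (p %% n) i.
    rewrite big1 // => k ki; apply/negbTE; apply: contraNneq ki => ->.
    by rewrite pi.
  rewrite (bigD1 (Ordinal ltpM)) //= eqxx big1 // => k /andP[_].
  by move=> /negbTE.
rewrite -big_split /=; apply: congr_big_nat => // k /and3P[_ _ lt_kM].
have lt_km := ltn_trans lt_kM lt_m.
have [lt_kp|lt_pk|kp] := ltngtP k p.
- by rewrite eq_tu.
- by have [-> ->] := tail k lt_pk lt_km.
- by rewrite kp up -?kp //= kp addTb.
Qed.

(** The position [p] lies in class [i] and is not counted; the digits counted after it are even. *)
Lemma odd_digit_sum_const p t i j j' : i < n ->
  p = i + j * n -> j <= j' -> (forall k, p < k -> k < i + j' * n -> ~~ odd (t k)) ->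
  odd (digit_sum n i j' t) = odd (digit_sum n i j t).
Proof.
move=> lt_in pE le_j even_t; rewrite !odd_digit_sum //.
rewrite (@big_cat_nat _ _ _ (i + j * n)) //=; last by rewrite leq_add2l leq_mul2r le_j orbT.
rewrite [X in _ (+) X]big1_seq ?addbF // => k /andP[ki].
rewrite mem_index_iota => /andP[lb ub]; apply/negbTE/even_t => //.
rewrite pE ltn_neqAle lb andbT; apply: contraNneq ki => <-.
by rewrite modnDM.
Qed.

Lemma coord_digits_carry N p t u i : i < n -> carry (N * n) p t u ->
  exists q, carry N q (coord_digits i t) (coord_digits i u) \/
            carry N q (coord_digits i u) (coord_digits i t).
Proof.
move=> lt_in tu; have [eq_tu up tail] := tu.
have in_range j : j < N -> i + j * n < N * n by nia.
have parity j ltjN := odd_digit_sum_carry _ _ _ _ _ j lt_in (in_range j ltjN) tu.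
have same j : j < N -> i + j * n < p -> coord_digits i t j = coord_digits i u j.
  move=> ltjN ltjp; rewrite /coord_digits !iter_xi parity //.
  by rewrite ltnNge (ltnW ltjp) /= eq_tu // in_range.
have [pi|/negbTE pi] := eqVneq (p %% n) i; last first.
  (* The first [N] digits turn out equal, which a carry at position [N] encodes. *)
  exists N; left; split=> [j _ ltjN||j]; [|by rewrite ltnn|by move=> /ltnW; rewrite leqNgt => /negbTE->].
  have [ltjp|ltpj|jp] := ltngtP (i + j * n) p; first exact: same.
    rewrite /coord_digits !iter_xi parity // ltpj pi /=.
    (* Opposite parities apply [xi] to exactly one of the digits 2 and 0, making them equal. *)
    have [t2 u0] := tail _ ltpj (in_range j ltjN).
    by apply: ord_inj; case: (odd _) => /=; rewrite ?t2 ?u0 ?xiE ?t2 ?u0.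
  by move: pi; rewrite -jp modnDM // eqxx.
have pE : p = i + p %/ n * n by rewrite {1}(divn_eq p n) pi addnC.
set q := p %/ n in pE.
have low j : j < q -> i + j * n < p by rewrite pE ltn_add2l ltn_mul2r => ->; case: n lt_in.
have high j : q < j -> p < i + j * n by rewrite pE ltn_add2l ltn_mul2r => ->; case: n lt_in.
(* From [q] on the parity is constant and common to [t] and [u]: [xi] acts on all digits or on
   none. *)
set b := odd (digit_sum n i q t).
have yt j : q <= j -> j < N -> coord_digits i t j =
    if b then xi (t (i + j * n)) else t (i + j * n).
  move=> leqj ltjN; rewrite /coord_digits iter_xi (odd_digit_sum_const p _ _ q) //.
  move=> k ltpk ltk.
  by have [-> _] := tail k ltpk (ltn_trans ltk (in_range j ltjN)).
have yu j : q <= j -> j < N -> coord_digits i u j =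
    if b then xi (u (i + j * n)) else u (i + j * n).
  move=> leqj ltjN; rewrite -[b]addFb /coord_digits iter_xi.
  rewrite parity // pi eqxx andbF /= (odd_digit_sum_const p _ _ q) //.
  move=> k ltpk ltk.
  by have [-> _] := tail k ltpk (ltn_trans ltk (in_range j ltjN)).
(* As [xi] reverses the order of digits, [t] and [u] swap roles when [b] is true. *)
exists q; case: b yt yu => yt yu; [right|left]; split.
- by move=> j /low ltjp ltjN; rewrite same.
- move=> ltqN; rewrite yt // yu // !xiE -pE up; last by rewrite pE in_range.
  (* The bound [u p <= 2] keeps the truncated subtractions in [xiE] exact. *)
  by have := ltn_ord (u p); rewrite up; last (by rewrite pE in_range); lia.
- move=> j ltqj ltjN; have leqj := ltnW ltqj; rewrite yt // yu // !xiE.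
  by have [-> ->] := tail _ (high j ltqj) (in_range j ltjN).
- by move=> j /low ltjp ltjN; rewrite same.
- by move=> ltqN; rewrite yt // yu // -pE up // pE in_range.
- move=> j ltqj ltjN; have leqj := ltnW ltqj; rewrite yt // yu //.
  by have [-> ->] := tail _ (high j ltqj) (in_range j ltjN).
Qed.

(** * Prescribing the digits of all coordinates *)

Lemma course_of_values (A : Type) (a0 : A) (F : nat -> (nat -> A) -> A) :
  (forall k f g, (forall l, l < k -> f l = g l) -> F k f = F k g) ->
  exists f, forall k, f k = F k f.
Proof.
move=> F_ext.
(* [P k] is a table correct below [k]; the solution is read off the diagonal. *)
pose P := fix P k : nat -> A :=
  if k is k'.+1 then fun l => if l == k' then F k' (P k') else P k' l
  else fun=> a0.
exists (fun k => P k.+1 k) => k; rewrite /= eqxx; apply: F_ext => l.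
elim: k => [//|k IH]; rewrite ltnS leq_eqVlt /= => /predU1P[->|lt_lk].
  by rewrite eqxx.
by rewrite (ltn_eqF lt_lk) IH.
Qed.

(** The exponent at a position depends only on earlier digits, and [xi] is an involution: applying
    the same power of [xi] to the wanted digit makes the two powers cancel. *)
Lemma coord_digits_surj (y : nat -> nat -> 'I_3) :
  exists t, forall i j, i < n -> coord_digits i t j = y i j.
Proof.
pose S k (f : nat -> 'I_3) := \sum_(0 <= l < k | l %% n != k %% n) f l.
have [k f g fg|t tE] :=
  course_of_values _ ord0 (fun k f => iter (S k f) xi (y (k %% n) (k %/ n))).
  congr (iter _ xi _); apply: congr_big_nat => // l /andP[_ /andP[_ lt_lk]].
  by rewrite fg.
exists t => i j lt_in; rewrite /coord_digits digit_sumE // tE /S.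
by rewrite modnDM // divnDM // -iterD addnn iter_xi odd_double.
Qed.

End PeanoDigits.

(** * The curve: independence of the representation, continuity, surjectivity *)

Section PeanoCurve.
Context {R : realType} {n : nat}.
Implicit Types (t u : nat -> 'I_3).
Local Notation V := (ternary_value R).

Lemma seq_coord_close N t u i : (i < n)%N -> `|V t - V u| < 3 ^- (N * n) ->
  `|seq_coord R n i t - seq_coord R n i u| <= 2 * 3 ^- N.
Proof.
move=> lt_in /carry_of_close[p [] /(coord_digits_carry _ _ _ _ _ _ lt_in)[q []]];
  by move=> /(@close_of_carry R) //; rewrite distrC.
Qed.

Lemma seq_coord_wd t u i : (i < n)%N -> V t = V u ->
  seq_coord R n i t = seq_coord R n i u.
Proof.
move=> lt_in tu; apply/eqP; rewrite -subr_eq0 -normr_eq0; apply/negPn/negP => nz.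
have d0 : 0 < `|seq_coord R n i t - seq_coord R n i u|.
  by rewrite lt_neqAle eq_sym nz normr_ge0.
have [|N] := @expr3V_lt R (`|seq_coord R n i t - seq_coord R n i u| / 2).
  by rewrite divr_gt0.
rewrite ltr_pdivlMr // mulrC ltNge seq_coord_close //.
by rewrite tu subrr normr0 expr3V_gt0.
Qed.

Lemma peano_coordE t i : (i < n)%N ->
  peano_coord n i (V t) = seq_coord R n i t.
Proof.
move=> lt_in; rewrite /peano_coord.
(* Either the chosen value is specialised at [t], or no value qualifies, which [seq_coord_wd]
   refutes. *)
case: xgetP => [v _ /(_ t erefl)->//|/(_ (seq_coord R n i t))[] u tu].
exact: seq_coord_wd.
Qed.

Lemma ternary_value_in01 t : V t \in `[0, 1].
Proof. by rewrite in_itv /= ternary_value_ge0 ternary_value_le1. Qed.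

Lemma peano_curve_continuous : {within `[0, 1], continuous (@peano_curve R n)}.
Proof.
apply/subspace_continuousP => x x01; apply/cvg_ballP => e e0.
(* With [2 * 3 ^- N < e], the radius [3 ^- (N * n)] serves at every [x]. *)
have [|N Ne] := @expr3V_lt R (e / 2); first by rewrite divr_gt0.
near=> y.
have [|t tx] := @ternary_value_surj R x; first by move: x01; rewrite /= in_itv.
have [|u uy] := @ternary_value_surj R y.
  have : `[0, 1]%classic y by near: y; exact: withinT.
  by rewrite /= in_itv.
rewrite -tx -uy; split=> // a i; rewrite !mxE !peano_coordE //.
rewrite /ball /=; apply: le_lt_trans (seq_coord_close N _ _ _ (ltn_ord i) _) _.
  rewrite tx uy; near: y; apply: cvg_within.
  exact: nbhsx_ballx (expr3V_gt0 _).
by rewrite mulrC -ltr_pdivlMr.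
Unshelve. all: by end_near. Qed.

Lemma peano_curve_in_cube : set_fun `[0, 1] (@unit_cube R n) (@peano_curve R n).
Proof.
move=> x; rewrite /= in_itv /= => /ternary_value_surj[t <-] i.
by rewrite mxE peano_coordE //; exact: (ternary_value_in01 (coord_digits n i t)).
Qed.

Lemma peano_curve_surj : set_surj `[0, 1] (@unit_cube R n) (@peano_curve R n).
Proof.
move=> v v01.
have /choice[y yv] : forall i : 'I_n, exists y, V y = v ord0 i.
  by move=> i; apply: ternary_value_surj; have := v01 i; rewrite in_itv.
(* Digits are prescribed for every natural index; [ord0] fills those outside ['I_n]. *)
have [t tE] := coord_digits_surj n (fun i j => if insub i is Some k then y k j else ord0).
exists (V t); first exact: ternary_value_in01.
apply/rowP => i; rewrite mxE peano_coordE // -yv.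
rewrite -[seq_coord _ _ _ _]/(V (coord_digits n i t)); congr (V _).
by apply/funext => j; rewrite tE // valK.
Qed.

End PeanoCurve.

Theorem theorem1 (R : realType) (n : nat) (hn : (2 <= n)%N) :
  {within `[0, 1], continuous (@peano_curve R n)} /\
  set_fun `[0, 1] (@unit_cube R n) (@peano_curve R n) /\
  set_surj `[0, 1] (@unit_cube R n) (@peano_curve R n).
Proof.
split; first exact: peano_curve_continuous.
split; [exact: peano_curve_in_cube|exact: peano_curve_surj].
Qed.
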